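(* Let $m>2$ be an integer. For any $k,n\in\mathbb{Z}$, $$\left\lfloor\frac{2kn}{m}\right\rfloor+\left\lfloor\frac{n}{m}\right\rfloor+\left\lfloor\frac{k+1}{m}\right\rfloor\ \geqslant\ \left\lfloor\frac{k}{m}\right\rfloor+\left\lfloor\frac{2n}{m}\right\rfloor+\left\lfloor\frac{kn}{m}\right\rfloor+\left\lfloor\frac{(k-1)n+1}{m}\right\rfloor.$$ *)

(* Defs.v *)
From mathcomp Require Export all_boot all_order all_algebra.

Set Implicit Arguments.
Unset Strict Implicit.
Unset Printing Implicit Defensive.

Import Order.TTheory GRing.Theory Num.Theory.
Local Open Scope ring_scope.

Definition floor_quot (a m : int) : int := Num.floor (a%:Q / m%:Q).

(* Main.v *)
(** Both sides change by the same amount when [k] or [n] is shifted by [m], so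
    take [0 <= k, n < m] and let [r] be the residue of [k n].  The inequality
    becomes
      [[m <= 2r] + [k = m - 1] >= [m <= 2n] - [r + 1 < n]],
    which can fail only if [r = n - 1] and [m] is [2n - 1] or [2n], with
    [k <> m - 1].  Then [(1 - k) n = 1] modulo [m]: if [m = 2n] this forces
    [n = 1], hence [m = 2]; if [m = 2n - 1] then [2] is the inverse of [n], so
    [k = -1] modulo [m]. *)
Require Import Defs.
From mathcomp Require Import all_boot all_order all_algebra.
From mathcomp Require Import zify ring.

Set Implicit Arguments.
Unset Strict Implicit.
Unset Printing Implicit Defensive.

Import Order.TTheory GRing.Theory Num.Theory.
Local Open Scope ring_scope.

Lemma floor_quot_eq (a m q : int) :
  0 < m -> q * m <= a < (q + 1) * m -> floor_quot a m = q.
Proof.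
move=> m_gt0 /andP[le_qa lt_aq]; apply: floor_def.
have mQ_gt0 : 0 < m%:Q by rewrite ltr0z.
by rewrite ler_pdivlMr // ltr_pdivrMr // -!intrM ler_int ltr_int le_qa.
Qed.

Lemma floor_quotMDl (q a m : int) :
  0 < m -> floor_quot (q * m + a) m = q + floor_quot a m.
Proof.
move=> m_gt0; rewrite /floor_quot rmorphD rmorphM /= mulrDl mulfK.
  by rewrite floorDzr ?intr_int // intrKfloor.
by rewrite intr_eq0 gt_eqF.
Qed.

(** Settles the critical case, where the residue of [k * n] is [n - 1]. *)
Lemma eq_predm_of_mul_eq_pred (m k n q : int) :
  2 < m -> 0 <= k < m -> m <= 2 * n <= m + 1 -> k * n = q * m + (n - 1) ->
  k = m - 1.
Proof.
move=> m_gt2 k_bd n_bd kn_eq.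
have [m_eq | m_eq] : m = 2 * n \/ m = 2 * n - 1 by lia.
  have n_unit : n * (1 + 2 * q - k) = 1 by move: kn_eq; rewrite m_eq; lia.
  have n_ge2 : 1 < n by lia.
  move: (1 + 2 * q - k) n_unit => c nc_eq1.
  by have [c_le0 | c_ge1] := lerP c 0; nia.
(* Double [kn_eq] and substitute [2 * n = m + 1]. As [0 < k + 1 <= m], the cofactor of [m] must be
   1. *)
have k1_eq : k + 1 = (2 * q + 1 - k) * m by move: kn_eq; rewrite m_eq; lia.
have c_gt0 : 0 < 2 * q + 1 - k by nia.
have c_le1 : 2 * q + 1 - k <= 1 by nia.
have c_eq1 : 2 * q + 1 - k = 1 by lia.
by move: k1_eq; rewrite c_eq1; lia.
Qed.

Theorem theorem2p2 (m : int) (hm : 2 < m) (k n : int) :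
  floor_quot (2 * k * n) m + floor_quot n m + floor_quot (k + 1) m
  >= floor_quot k m + floor_quot (2 * n) m + floor_quot (k * n) m
     + floor_quot ((k - 1) * n + 1) m.
Proof.
have m_gt0 : 0 < m by lia.
have m_neq0 : m != 0 by lia.
have := modz_ge0 k m_neq0; have := ltz_pmod k m_gt0; have := divz_eq k m.
move: (k %/ m)%Z (k %% m)%Z => K k0 -> k0_lt k0_ge {k}.
have := modz_ge0 n m_neq0; have := ltz_pmod n m_gt0; have := divz_eq n m.
move: (n %/ m)%Z (n %% m)%Z => N n0 -> n0_lt n0_ge {n}.
have := modz_ge0 (k0 * n0) m_neq0; have := ltz_pmod (k0 * n0) m_gt0.
have := divz_eq (k0 * n0) m.
(* Keeps [r - n0 + 1] below [m]: the bound [r < m] alone would allow [n0 = 0] with [r = m - 1]. *)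
have : n0 = 0 -> (k0 * n0 %% m)%Z = 0 by move=> ->; rewrite mulr0 mod0z.
move: (k0 * n0 %/ m)%Z (k0 * n0 %% m)%Z => q r r_eq0 kn_eq r_lt r_ge.
have r_eq : r = k0 * n0 - q * m by rewrite kn_eq; ring.
(* The quotient of the original product [k * n] by [m], with remainder [r]. *)
pose c := K * N * m + K * n0 + N * k0 + q.
have -> : 2 * (K * m + k0) * (N * m + n0) = (2 * c) * m + 2 * r.
  by rewrite r_eq /c; ring.
have -> : (K * m + k0) * (N * m + n0) = c * m + r by rewrite r_eq /c; ring.
have -> : (K * m + k0 - 1) * (N * m + n0) + 1 = (c - N) * m + (r - n0 + 1).
  by rewrite r_eq /c; ring.
have -> : 2 * (N * m + n0) = (2 * N) * m + 2 * n0 by ring.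
rewrite -(addrA (K * m)) !floor_quotMDl //.
rewrite (@floor_quot_eq k0 m 0) ?(@floor_quot_eq n0 m 0) ?(@floor_quot_eq r m 0); try lia.
have k1 : floor_quot (k0 + 1) m = (k0 == m - 1)%R%:Z.
  by apply: floor_quot_eq => //; case: eqP; lia.
have r2 : floor_quot (2 * r) m = (m <= 2 * r)%R%:Z.
  by apply: floor_quot_eq => //; case: lerP; lia.
have n2 : floor_quot (2 * n0) m = (m <= 2 * n0)%R%:Z.
  by apply: floor_quot_eq => //; case: lerP; lia.
have rn : floor_quot (r - n0 + 1) m = - (r + 1 < n0)%R%:Z.
  apply: floor_quot_eq => //.
  by case: ltrP; lia.
rewrite k1 r2 n2 rn.
(* A failure needs [2 * r < m <= 2 * n0] and [n0 <= r + 1], hence [r = n0 - 1] and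
   [2 * n0 <= m + 1]. *)
have := @eq_predm_of_mul_eq_pred m k0 n0 q hm.
have : n0 - 1 = r -> k0 * n0 = q * m + (n0 - 1) by move=> ->.
lia.
Qed.
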